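(* $\mathrm{SSCM}(3,1;5;2,2)=\mathrm{RE}$. That is, a language is recursively enumerable if and only if it is generated by a simple semi-conditional matrix grammar of degree $(3,1)$ with at most $5$ nonterminals, at most $2$ conditional matrices, and all matrices of length at most $2$.
   Context: A semi-conditional matrix (SCM) grammar is a quadruple $G=(V,T,M,S)$ with the following components. - $V$ is a finite alphabet and $T\subsetneq V$ is the set of terminals. - $N=V\setminus T$ is the set of nonterminals and $S\in N$ is the start symbol. - $M$ is a finite set of matrices of the form $r=[(A_1\to x_1),\dots,(A_\ell\to x_\ell),P,F]$, where $\ell\ge 1$, $A_k\in N$, $x_k\in V^*$, and $P,F\in V^+\cup\{\emptyset\}$. Here $\emptyset\notin V$ is a special symbol meaning that the condition is absent, and $|\emptyset|=0$. The number $\ell$ is the length of $r$. A matrix is classified as follows: - unconditional if $P=F=\emptyset$, and conditional otherwise; - simple if at least one of $P,F$ equals $\emptyset$, and non-simple if both $P\neq\emptyset$ and $F\neq\emptyset$. For $x,y\in V^*$ we write $x\Rightarrow_r y$ iff all of the following hold: 1. if $P\neq\emptyset$ then $P$ is a subword (factor) of $x$; 2. if $F\neq\emptyset$ then $F$ is not a subword of $x$; 3. there are words $x=y_0,y_1,\dots,y_\ell=y$ such that $y_k$ is obtained from $y_{k-1}$ by replacing one occurrence of $A_k$ by $x_k$. $\Rightarrow_G$ is the union of the relations $\Rightarrow_r$ over $r\in M$, and $L(G)=\{y\in T^*: S\Rightarrow_G^* y\}$. $G$ has degree $(i,j)$ if every matrix satisfies $|P|\le i$ and $|F|\le j$. $\mathrm{SCM}(i,j;n;m,\ell,s)$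 denotes the family of languages $L(G)$ of SCM grammars $G$ that satisfy all of the following: - $G$ has degree $(i,j)$; - $|N|\le n$; - $G$ has at most $m$ conditional matrices; - every matrix of $G$ has length at most $\ell$; - $G$ has at most $s$ non-simple matrices. A $*$ in a parameter position means that parameter is unbounded. $\mathrm{SSCM}(i,j;n;m,\ell)=\mathrm{SCM}(i,j;n;m,\ell,0)$, i.e., all matrices are simple. $\mathrm{RE}$ is the class of recursively enumerable languages. *)

(* Defs.v *)
From mathcomp Require Import all_boot.
From Stdlib Require Lists.List.
Set Implicit Arguments. Unset Strict Implicit. Unset Printing Implicit Defensive.

Definition language (T : finType) := seq T -> Prop.

Definition symb (T N : finType) := (T + N)%type.

Inductive star (A : Type) (R : A -> A -> Prop) : A -> A -> Prop :=
| star_refl x : star R x x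
| star_step x y z : R x y -> star R y z -> star R x z.

Record ps_grammar (T : finType) := PSGrammar {
  ps_N : finType;
  ps_S : ps_N;
  ps_rules : seq (seq (symb T ps_N) * seq (symb T ps_N))
}.

Definition is_nt (T N : finType) (a : symb T N) : bool :=
  if a is inr _ then true else false.

Definition ps_step (T : finType) (G : ps_grammar T) (x y : seq (symb T (ps_N G))) : Prop :=
  exists r, r \in ps_rules G /\ has (@is_nt T (ps_N G)) r.1 /\
    exists a b, x = a ++ r.1 ++ b /\ y = a ++ r.2 ++ b.

Definition ps_lang (T : finType) (G : ps_grammar T) : language T :=
  fun w => star (@ps_step T G) [:: inr (ps_S G)] (map inl w).

Definition RE (T : finType) (L : language T) : Prop :=
  exists G : ps_grammar T, forall w, L w <-> ps_lang G w.

(* The absent condition (the symbol "emptyset", of length 0) is        *)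
(* represented by the empty word [::]; a present condition is a        *)
(* nonempty word, so P,F : seq V encode exactly V^+ \cup {emptyset}.   *)
Record scm_matrix (T N : finType) := SCMMatrix {
  m_rules : seq (N * seq (symb T N));
  m_P : seq (symb T N);
  m_F : seq (symb T N)
}.

Record scm_grammar (T : finType) := SCMGrammar {
  g_N : finType;
  g_S : g_N;
  g_M : seq (scm_matrix T g_N)
}.

Fixpoint apply_rules (T N : finType) (rs : seq (N * seq (symb T N)))
    (x y : seq (symb T N)) : Prop :=
  match rs with
  | [::] => x = y
  | (A, u) :: rs' =>
      exists a b, x = a ++ [:: inr A] ++ b /\ apply_rules rs' (a ++ u ++ b) y
  end.

Definition matrix_step (T N : finType) (r : scm_matrix T N) (x y : seq (symb T N)) : Prop :=
  (m_P r != [::] -> infix (m_P r) x) /\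
  (m_F r != [::] -> ~~ infix (m_F r) x) /\
  apply_rules (m_rules r) x y.

Definition scm_step (T : finType) (G : scm_grammar T) (x y : seq (symb T (g_N G))) : Prop :=
  exists r, Stdlib.Lists.List.In r (g_M G) /\ matrix_step r x y.

Definition scm_lang (T : finType) (G : scm_grammar T) : language T :=
  fun w => star (@scm_step T G) [:: inr (g_S G)] (map inl w).

Definition conditional (T N : finType) (r : scm_matrix T N) : bool :=
  (m_P r != [::]) || (m_F r != [::]).

Definition nonsimple (T N : finType) (r : scm_matrix T N) : bool :=
  (m_P r != [::]) && (m_F r != [::]).

Definition scm_params (T : finType) (G : scm_grammar T) (i j n m l s : nat) : Prop :=
  [/\ all (fun r => (size (m_P r) <= i) && (size (m_F r) <= j)) (g_M G),
      #|g_N G| <= n,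
      count (@conditional T (g_N G)) (g_M G) <= m,
      all (fun r => (0 < size (m_rules r)) && (size (m_rules r) <= l)) (g_M G)
    & count (@nonsimple T (g_N G)) (g_M G) <= s].

Definition in_SSCM (T : finType) (i j n m l : nat) (L : language T) : Prop :=
  exists G : scm_grammar T, scm_params G i j n m l 0 /\ forall w, L w <-> scm_lang G w.

(* Main.v *)
Require Import Defs.
From mathcomp Require Import all_boot zify.
Set Implicit Arguments. Unset Strict Implicit. Unset Printing Implicit Defensive.

(* A phrase structure grammar G is turned into a domino (Post correspondence)
   system: the lower words first spell w and then the sentential forms obtained
   from w by applying the rules of G backwards, the upper words consume them as
   a queue, and the two agree iff w reduces to the start symbol. With binary
   codes, S generates the word w U V, where each bit x of the upper word is
   written A B^x in U and each bit y of the lower word is written B^(1-y) C, in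
   reverse order, in V. The words agree iff at every stage exactly one B stands
   between the last A and the first C. One matrix turns an A and a C into # when
   there is no #; one requires #B# and erases a #; an unconditional one erases a
   # together with some B. Counting B's shows that a successful derivation passes
   the test in every cycle. The erased B need not be the tested one, so what is
   tested is only that the upper word is dominated by the lower word in all suffix
   sums; the codes are chosen such that domination forces equality.
   Conversely, a phrase structure grammar simulates matrices by a head that scans
   the sentential form between two end markers. *)

Lemma cat_eq_cat_cons (X : Type) (l r a b : seq X) (z : X) :
  l ++ r = a ++ z :: b ->
  (exists c, l = a ++ z :: c /\ b = c ++ r) \/
  (exists c, r = c ++ z :: b /\ a = l ++ c).
Proof.
elim: l a => [|y l IH] [|y' a] /=; first by move=> ->; right; exists [::].
- by move=> ->; right; exists (y' :: a).
- by case=> -> <-; left; exists l.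
case=> -> /IH [[c [-> ->]]|[c [-> ->]]]; first by left; exists c.
by right; exists c.
Qed.

Lemma star_trans (X : Type) (R : X -> X -> Prop) x y z :
  star R x y -> star R y z -> star R x z.
Proof. by elim=> // {}x y' {}y xy' _ IH /IH; apply: star_step. Qed.

Lemma star1 (X : Type) (R : X -> X -> Prop) x y : R x y -> star R x y.
Proof. by move=> xy; apply: star_step xy (star_refl _ _). Qed.

(** * Domino systems and phrase structure grammars *)

Section Dominoes.
Variables (T X : eqType).

Definition domino := (seq T * seq X * seq X)%type.
Definition emitted (g : seq domino) := flatten [seq d.1.1 | d <- g].
Definition uppers (g : seq domino) := flatten [seq d.1.2 | d <- g].
Definition lowers (g : seq domino) := flatten [seq d.2 | d <- g].

(* A terminal emitted after a nonempty upper word would stay between the A's and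
   the C's of the generated word and block their erasure. *)
Fixpoint emits_first (g : seq domino) :=
  if g is d :: g' then
    emits_first g' && ((d.1.2 == [::]) || all (fun e : domino => e.1.1 == [::]) g')
  else true.

Definition pcp_lang (D : seq domino) (u : seq X) (w : seq T) : Prop :=
  exists g, [/\ {subset g <= D}, emits_first g,
                uppers g ++ u = lowers g & emitted g = w].

End Dominoes.

(** * The domino system of a phrase structure grammar *)

Section PcpOfGrammar.
Variables (T : finType) (G : ps_grammar T).
Local Notation V := (symb T (ps_N G)).

(* A queue letter is a symbol of G or the cut mark [None]; the queue y # x
   stands for the sentential form x y. Domino words interleave queue letters
   with a separator, [None] of the outer option. *)
Local Notation Q := (option V).
Local Notation L := (option Q).

(** Lower words put the separator before each letter and upper words after it. The upper side thus
    lags by one separator, which fixes the domino that must consume first. *)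
Definition sep_before (q : seq Q) : seq L := flatten [seq [:: None; Some c] | c <- q].
Definition sep_after (q : seq Q) : seq L := flatten [seq [:: Some c; None] | c <- q].

Definition emit_domino (t : T) : domino T L :=
  ([:: t], [::], sep_before [:: Some (inl t)]).
(** The only domino whose upper word begins with the separator. It supplies the separator that the
    upper side lacks and closes the emitted word with the cut mark. *)
Definition start_domino : domino T L := ([::], [:: None], sep_before [:: None]).
(** Consumes the right side of a rule and appends the left side. The letter [c] copied along keeps
    the upper word nonempty for erasing rules, and with the empty rule it yields the copying
    dominoes. *)
Definition rewrite_domino (r : seq V * seq V) (c : Q) : domino T L :=
  ([::], sep_after (rcons (map Some r.2) c), sep_before (rcons (map Some r.1) c)).

Definition live_rules := [seq r <- ps_rules G | has (@is_nt T (ps_N G)) r.1].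
Definition rewrite_dominoes :=
  [seq rewrite_domino r c | r <- ([::], [::]) :: live_rules, c <- enum {: Q}].
Definition ps_dominoes : seq (domino T L) :=
  map emit_domino (enum T) ++ start_domino :: rewrite_dominoes.
(** The queue holding the start symbol and the cut mark. Its missing last separator compensates the
    extra one of [start_domino]. *)
Definition ps_final : seq L := [:: Some (Some (inr (ps_S G))); None; Some None].

Lemma sep_before_cat p q : sep_before (p ++ q) = sep_before p ++ sep_before q.
Proof. by rewrite /sep_before map_cat flatten_cat. Qed.

Lemma sep_after_shift p s : None :: sep_after p ++ s = sep_before p ++ None :: s.
Proof. by elim: p => //= c p <-. Qed.

Lemma sep_before_prefix p q s s' :
  sep_before p ++ s = sep_before q ++ s' ->
  (exists q', q = p ++ q' /\ s = sep_before q' ++ s') \/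
  (exists c p', p = q ++ c :: p').
Proof.
elim: p q => [|c p IH] [|c' q] /=.
- by move=> ->; left; exists [::].
- by move=> ->; left; exists (c' :: q).
- by move=> _; right; exists c, p.
case=> -> /IH [[q' [-> ->]]|[d [p' ->]]]; first by left; exists q'.
by right; exists d, p'.
Qed.

Lemma rewrite_dominoesP d : reflect
  (exists r c, (r = ([::], [::]) \/ r \in live_rules) /\ d = rewrite_domino r c)
  (d \in rewrite_dominoes).
Proof.
apply: (iffP allpairsP) => [[[r c] /= [r_in _ ->]]|[r [c [r_in ->]]]].
  exists r, c; split => //; move: r_in; rewrite inE => /orP[/eqP ->|]; by [left|right].
exists (r, c); split => //=; last by rewrite mem_enum.
by rewrite inE; case: r_in => [->|->]; rewrite ?eqxx ?orbT.
Qed.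

(** The rewriting dominoes can take the queue [q] to the final one. The leading [None] is the
    separator contributed by [start_domino]. *)
Definition queue_solvable (q : seq Q) : Prop :=
  exists2 g, {subset g <= rewrite_dominoes} &
    None :: uppers g ++ ps_final = sep_before q ++ lowers g.

Lemma queue_solvable_rewrite r c q :
  r = ([::], [::]) \/ r \in live_rules ->
  queue_solvable (q ++ rcons (map Some r.1) c) ->
  queue_solvable (rcons (map Some r.2) c ++ q).
Proof.
move=> r_in [g gD E]; exists (rewrite_domino r c :: g).
  move=> d; rewrite inE => /orP[/eqP ->|/gD //].
  by apply/rewrite_dominoesP; exists r, c.
rewrite /uppers /lowers /= -/(uppers g) -/(lowers g) -catA sep_after_shift E.
by rewrite !sep_before_cat -!catA.
Qed.

(** Copying dominoes move the letters of [a] one by one from the front of the queue to its end. *)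
Lemma queue_solvable_rot a q : queue_solvable (q ++ a) -> queue_solvable (a ++ q).
Proof.
elim/last_ind: a q => [|a c IH] q; first by rewrite cats0.
rewrite -rcons_cat => H; rewrite cat_rcons; apply: (IH (c :: q)).
apply: (@queue_solvable_rewrite ([::], [::]) c (q ++ a)); first by left.
by rewrite /= cats1.
Qed.

Lemma queue_solvable_step x y : ps_step x y ->
  queue_solvable (rcons (map Some x) None) -> queue_solvable (rcons (map Some y) None).
Proof.
case=> r [r_in [r_nt [a [b [-> ->]]]]]; rewrite !map_cat !rcons_cat.
(* The letter [c] carried by the domino is the one right after the rewritten factor, possibly the
   cut mark. The parts before and after are rotated. *)
case E: (rcons (map Some b) None) => [|c b']; first by case: (map _ b) E.
rewrite -!cat_rcons [map Some a ++ _]catA => /queue_solvable_rot H.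
rewrite catA; apply: (@queue_solvable_rot (map Some a ++ rcons (map Some r.2) c) b').
rewrite -/(cat _ _) catA; apply: queue_solvable_rot.
apply: (@queue_solvable_rewrite r c (b' ++ map Some a)); first by right; rewrite mem_filter r_nt.
by rewrite -catA.
Qed.

Lemma queue_solvable_derived w : ps_lang G w ->
  queue_solvable (rcons (map Some (map inl w)) None).
Proof.
rewrite /ps_lang; set s := [:: _].
have : queue_solvable (rcons (map Some s) None) by exists [::].
by move=> H D; elim: D H => // x y z xy _ IH H; apply/IH/(queue_solvable_step xy).
Qed.

(** * From queue runs back to derivations *)

Lemma cut_position (X : Type) (y a : seq X) c q s :
  map Some y ++ None :: s = rcons (map Some a) c ++ q ->
  [/\ c = None, y = a & q = s] \/
  exists v y', [/\ c = Some v, y = a ++ v :: y' & q = map Some y' ++ None :: s].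
Proof.
elim: y a => [|v y IH] [|v' a] //=.
- by case=> <- <-; left.
- by case=> <- <-; right; exists v, y.
case=> -> /IH [[-> -> ->]|[u [y' [-> -> ->]]]]; first by left.
by right; exists u, y'.
Qed.

(** Induction on the dominoes: each one consumes a prefix of the queue, and undoing its rule in the
    form [x ++ y] gives the form of the next queue. The run ends at the start symbol, so read
    backwards it is a derivation. *)
Lemma derived_of_queue (g : seq (domino T L)) (x y : seq V) :
  {subset g <= start_domino :: rewrite_dominoes} ->
  None :: uppers g ++ ps_final =
    sep_before (map Some y ++ None :: map Some x) ++ lowers g ->
  star (@ps_step T G) [:: inr (ps_S G)] (x ++ y).
Proof.
elim: g x y => [|d g IH] x y gD.
  case: y => [|a [|b y]] //= [] <-.
  by case: x => //= _; apply: star_refl.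
have /IH {}IH : {subset g <= start_domino :: rewrite_dominoes}.
  by move=> e eg; apply: gD; rewrite inE eg orbT.
rewrite /uppers /lowers /= -/(uppers g) -/(lowers g) => E.
have := gD d (mem_head _ _); rewrite inE => /orP[/eqP ed|].
  (* After the pending separator a queue letter must follow, not the separator of another
     [start_domino]. *)
  by move: E; rewrite ed; case: y => //=.
case/rewrite_dominoesP => r [c [r_in ed]].
have step a b : star (@ps_step T G) [:: inr (ps_S G)] (a ++ r.1 ++ b) ->
    star (@ps_step T G) [:: inr (ps_S G)] (a ++ r.2 ++ b).
  case: r_in => [-> //|r_in D]; apply: star_trans D (star1 _).
  by move: r_in; rewrite mem_filter => /andP[r_nt r_in]; exists r; do 2!split=> //; exists a, b.
move: E; rewrite ed /= -[(sep_after _ ++ _) ++ _]catA sep_after_shift.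
case/sep_before_prefix => [[q' [Eq E]]|[c' [p' Eq]]]; last first.
  (* An upper word longer than the queue would contain the cut mark before its last letter, but only
     the last letter can be that mark. *)
  move: Eq; rewrite -cats1 -catA => Eq.
  case: (cat_eq_cat_cons Eq) => [[m [m1 _]]|[m [m1 _]]].
    have : None \in map Some r.2 by rewrite m1 mem_cat mem_head orbT.
    by case/mapP.
  by move/(congr1 size): m1; rewrite size_cat /= size_cat /=; lia.
(* Either the domino carries the cut mark along, and then the whole new form precedes it, or it
   rewrites strictly before the mark. *)
case: (cut_position Eq) => [[cE -> q'E]|[v [y' [cE -> q'E]]]].
  move: (IH [::] (x ++ r.1)); rewrite map_cat -catA => {}IH.
  have := step x [::]; rewrite !cats0; apply; apply: IH.
  by rewrite E q'E cE -cats1 !sep_before_cat -!catA.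
have -> : x ++ r.2 ++ v :: y' = x ++ r.2 ++ (v :: y') by [].
apply: step; rewrite -cat_rcons catA; apply: IH.
rewrite E q'E cE -map_rcons map_cat -cat_cons.
by rewrite [in RHS]catA [in RHS]sep_before_cat -catA.
Qed.

(** All other dominoes have nonempty upper words, so [emits_first] puts every emitting domino in
    front of them. *)
Lemma ps_dominoes_split g : {subset g <= ps_dominoes} -> emits_first g ->
  exists w g', g = map emit_domino w ++ g' /\
    {subset g' <= start_domino :: rewrite_dominoes}.
Proof.
have upper d : d \in start_domino :: rewrite_dominoes -> d.1.2 != [::].
  rewrite inE => /orP[/eqP -> //|/rewrite_dominoesP[r [c [_ ->]]]] /=.
  by case: r.2.
elim: g => [|d g IH] gD /=; first by exists [::], [::].
case/andP=> /IH; case=> [e eg|w [g' [gE g'D]]]; first by apply: gD; rewrite inE eg orbT.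
have := gD d (mem_head _ _); rewrite mem_cat => /orP[/mapP[t _ ->] _|dD].
  by exists (t :: w), g'; rewrite gE.
case/orP=> [/(negP (upper _ dD)) //|silent].
case: w gE => [|t w] gE; last by move: silent; rewrite gE.
exists [::], (d :: g); split => // e; rewrite inE => /orP[/eqP -> //|].
by rewrite gE => /g'D.
Qed.

Lemma emitted_emit w : emitted (map emit_domino w) = w.
Proof. by elim: w => //= t w; rewrite /emitted /= => ->. Qed.

Lemma uppers_emit w g : uppers (map emit_domino w ++ g) = uppers g.
Proof. by elim: w. Qed.

Lemma lowers_emit w g :
  lowers (map emit_domino w ++ g) = sep_before (map Some (map inl w)) ++ lowers g.
Proof. by elim: w => //= t w; rewrite /lowers /= => ->. Qed.

Lemma emitted_silent (g : seq (domino T L)) :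
  {subset g <= start_domino :: rewrite_dominoes} ->
  all (fun e : domino T L => e.1.1 == [::]) g.
Proof.
move=> gD; apply/allP=> d /gD; rewrite inE => /orP[/eqP -> //|].
by case/rewrite_dominoesP=> r [c [_ ->]].
Qed.

Lemma emitted_nil (g : seq (domino T L)) :
  all (fun e : domino T L => e.1.1 == [::]) g -> emitted g = [::].
Proof. by elim: g => //= d g IH /andP[/eqP dE /IH]; rewrite /emitted /= dE. Qed.

Theorem ps_lang_pcp w : ps_lang G w <-> pcp_lang ps_dominoes ps_final w.
Proof.
split=> [/queue_solvable_derived[g gD E]|].
  exists (map emit_domino w ++ start_domino :: g); split.
  - move=> d; rewrite !mem_cat !inE => /or3P[/mapP[t _ ->]|->|/gD ->].
    + by rewrite map_f ?mem_enum.
    + by rewrite orbT.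
    + by rewrite !orbT.
  - have : emits_first (start_domino :: g).
      rewrite /= (@emitted_silent g) ?andbT; last by move=> d /gD; rewrite inE orbC => ->.
      elim: g gD {E} => //= d g IH gD.
      rewrite IH ?(@emitted_silent g) ?orbT // => e eg;
        by [apply: gD; rewrite inE eg orbT|rewrite inE gD ?orbT // inE eg orbT].
    by elim: (w) => //= t w' IH /IH ->.
  - rewrite uppers_emit lowers_emit /uppers /lowers /= -/(uppers g) -/(lowers g) E.
    by rewrite -cats1 sep_before_cat -catA.
  - rewrite /emitted map_cat flatten_cat -!/(emitted _) emitted_emit.
    have gs : all (fun e : domino T L => e.1.1 == [::]) g.
      by apply: emitted_silent => d /gD; rewrite inE orbC => ->.
    by rewrite /emitted /= -/(emitted g) (emitted_nil gs) cats0.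
case=> g [gD ef E <-]; have [u [g' [gE g'D]]] := ps_dominoes_split gD ef.
have -> : emitted g = u.
  rewrite gE /emitted map_cat flatten_cat -!/(emitted _) emitted_emit.
  suff -> : emitted g' = [::] by rewrite cats0.
  exact: emitted_nil (emitted_silent g'D).
move: E; rewrite gE uppers_emit lowers_emit {g gD ef gE}.
case: g' g'D => [|d g] gD; first by case: u => //=.
have gD' : {subset g <= start_domino :: rewrite_dominoes}.
  by move=> e eg; apply: gD; rewrite inE eg orbT.
have := gD d (mem_head _ _); rewrite inE => /orP[/eqP ->|].
  rewrite {1}/uppers /lowers /= -/(uppers g) -/(lowers g) => E.
  apply: (@derived_of_queue g [::] (map inl u) gD').
  by rewrite E sep_before_cat -catA.
(* A rewriting domino cannot be the first to consume: its upper word begins with a letter, the lower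
   side with a separator. *)
case/rewrite_dominoesP=> r [c [_ ->]].
rewrite {1}/uppers /lowers /=; by case: u r.2 r.1 => [|t u] [|a r2] [|b r1].
Qed.

End PcpOfGrammar.

Lemma cat_cons_unique (X : eqType) (z : X) (a b a' b' : seq X) :
  z \notin a -> z \notin b -> a' ++ z :: b' = a ++ z :: b -> a' = a /\ b' = b.
Proof.
move=> za zb E; case: (cat_eq_cat_cons E) => {E} [[c [E1 E2]]|[[|y c] [E1 E2]]].
- by move: zb; rewrite E2 mem_cat mem_head orbT.
- by case: E1 => ->; rewrite E2 cats0.
- by case: E1 E2 za => <- _ ->; rewrite mem_cat mem_head orbT.
Qed.

(** * Erasing from the center *)

Fixpoint steps (X : Type) (R : X -> X -> Prop) n x y :=
  if n is n'.+1 then exists2 z, R x z & steps R n' z y else x = y.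

Definition NT := option (bool * bool).
Definition nS : NT := None.
Definition nA : NT := Some (false, false).
Definition nB : NT := Some (false, true).
Definition nC : NT := Some (true, false).
Definition nM : NT := Some (true, true).

Lemma nt_eqE :
  ((nA == nB = false) * (nA == nC = false) * (nA == nM = false) * (nA == nS = false) *
   (nB == nA = false) * (nB == nC = false) * (nB == nM = false) * (nB == nS = false) *
   (nC == nA = false) * (nC == nB = false) * (nC == nM = false) * (nC == nS = false) *
   (nM == nA = false) * (nM == nB = false) * (nM == nC = false) * (nM == nS = false) *
   (nS == nA = false) * (nS == nB = false) * (nS == nC = false) * (nS == nM = false))%type.
Proof. by []. Qed.

Section Words.
Variable T : finType.
Local Notation W := (seq (symb T NT)).
Local Notation "''S'" := (inr nS : symb T NT).
Local Notation "''A'" := (inr nA : symb T NT).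
Local Notation "''B'" := (inr nB : symb T NT).
Local Notation "''C'" := (inr nC : symb T NT).
Local Notation "''M'" := (inr nM : symb T NT).

Definition cnt (c : NT) (s : W) := count (pred1 (inr c)) s.
Definition is_term (a : symb T NT) := ~~ is_nt a.
Definition terms (s : W) := pmap (fun a : symb T NT => if a is inl t then Some t else None) s.

Lemma cnt_cat c s1 s2 : cnt c (s1 ++ s2) = cnt c s1 + cnt c s2.
Proof. exact: count_cat. Qed.
Lemma cnt_nil c : cnt c [::] = 0. Proof. by []. Qed.
Lemma cnt_inr c d s : cnt c (inr d :: s) = (d == c) + cnt c s. Proof. by []. Qed.
Lemma cnt_inl c t s : cnt c (inl t :: s) = cnt c s. Proof. by []. Qed.
Lemma cnt_terms c w : cnt c (map inl w) = 0. Proof. by elim: w. Qed.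
Definition cntE := (cnt_cat, cnt_inr, cnt_inl, cnt_nil, cnt_terms, eqxx, nt_eqE).

Lemma notin_cnt c s : (inr c \notin s) = (cnt c s == 0).
Proof. by rewrite -has_pred1 has_count -leqNgt leqn0. Qed.

#[local] Opaque cnt nA nB nC nM nS.

Definition mark_rules : seq (NT * W) := [:: (nA, [:: 'M]); (nC, [:: 'M])].
Definition check_rules : seq (NT * W) := [:: (nM, [::])].
Definition erase_rules : seq (NT * W) := [:: (nM, [::]); (nB, [::])].

Inductive red (x y : W) : Prop :=
| red_mark of 'M \notin x & apply_rules mark_rules x y
| red_check of infix [:: 'M; 'B; 'M] x & apply_rules check_rules x y
| red_erase of apply_rules erase_rules x y.

(** The effect of a cycle whose test succeeds. The decomposition by [a] and [b] allows the erased B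
    to differ from the tested one. *)
Definition removes_at_center (x y : W) := exists p q a b,
  (x = p ++ 'A :: 'B :: 'C :: q \/ x = p ++ 'C :: 'B :: 'A :: q) /\
  p ++ 'B :: q = a ++ 'B :: b /\ y = a ++ b.

(** The effect of a cycle that avoids the test: both marks are erased together with a B. *)
Definition removes_elsewhere (x y : W) :=
  [/\ cnt nA x = (cnt nA y).+1, cnt nC x = (cnt nC y).+1 & cnt nB x = (cnt nB y).+2].

(** A single mark rules out both conditional matrices: marking needs none, the test needs two. *)
Lemma red_marked x y : red x y -> cnt nM x = 1 ->
  exists e f a b, [/\ x = e ++ 'M :: f, e ++ f = a ++ 'B :: b & y = a ++ b].
Proof.
case=> [|/infixP[p [q ->]] _|[e [f [-> [a [b [ef yE]]]]]] _].
- by rewrite notin_cnt => /eqP -> _.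
- by rewrite !cntE; clear; lia.
by exists e, f, a, b.
Qed.

(** Without marks only marking is possible. The two marks block further marking until both are gone,
    and the last of them can disappear only with a B. A cycle is therefore a marking, a test or an
    erasure, and an erasure. *)
Lemma red_cycle n x w : 'M \notin x -> steps red n x (map inl w) ->
  x = map inl w \/
  exists m y, [/\ m < n, 'M \notin y, steps red m y (map inl w) &
                  removes_at_center x y \/ removes_elsewhere x y].
Proof.
case: n => [|n] xM; first by left.
case=> z + zw; move: xM; rewrite notin_cnt => /eqP xM.
case=> [_|/infixP[p [q xE]] _|[e [f [xE _]]]]; try by move: xM; rewrite xE !cntE; clear; lia.
case=> [a [b [xE [a' [b' [zE1 zE]]]]]].
have zM : cnt nM z = 2 by move: (congr1 (cnt nM) zE1) xM; rewrite -zE xE !cntE; clear; lia.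
case: n zw => [/= zw|n]; first by move: zM; rewrite zw cntE.
case=> z2 zz2; have z2M : cnt nM z2 = 1.
  case: zz2 => [|_ [e [f [zE2 <-]]]|[e [f [zE2 [g [h [E <-]]]]]]].
  - by rewrite notin_cnt zM.
  - by move: zM; rewrite zE2 !cntE; clear; lia.
  - by move: zM (congr1 (cnt nM) E); rewrite zE2 !cntE; clear; lia.
case: n => [/= zw|n]; first by move: z2M; rewrite zw cntE.
case=> y /red_marked/(_ z2M) [e [f [g [h [z2E efE yE]]]]] yw; right; exists n, y; split=> //; first by lia.
  by rewrite notin_cnt; move: z2M (congr1 (cnt nM) efE); rewrite z2E yE !cntE; clear; lia.
case: zz2 => [|/infixP[p [q zE2]] [e' [f' [zE3 z2E']]]|[e' [f' [zE2 [g' [h' [E z2E']]]]]]].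
- by rewrite notin_cnt zM.
- left; have [pM qM] : 'M \notin p /\ 'M \notin q.
    by rewrite !notin_cnt; move: zM; rewrite zE2 !cntE; clear; lia.
  (* Since [z] has just two marks, each mark met in a decomposition is the one left or the one right
     of the tested B. *)
  have split2 a1 b1 : a1 ++ 'M :: b1 = p ++ 'M :: 'B :: 'M :: q ->
      (a1 = p /\ b1 = 'B :: 'M :: q) \/ (a1 = p ++ [:: 'M; 'B] /\ b1 = q).
    move=> E; case: (cat_eq_cat_cons E) => {E} [[c [E1 E2]]|[c [E1 E2]]].
      have E3 : c ++ 'M :: b1 = [:: 'B] ++ 'M :: q by rewrite -E2.
      by case: (cat_cons_unique (_ : 'M \notin [:: 'B]) qM E3) => // cE ->; right; rewrite E1 cE.
    case: c E1 E2 => [|x1 c] /= [].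
      by move=> ->; rewrite cats0 => ->; left.
    by move=> <- _ pE; move: pM; rewrite pE mem_cat mem_head orbT.
  have efpq : e ++ f = p ++ 'B :: q.
    move: z2E'; rewrite z2E /=; case: (split2 _ _ (etrans (esym zE3) zE2)) => [[-> ->]|[-> ->]] E.
      have E4 : e ++ 'M :: f = (p ++ [:: 'B]) ++ 'M :: q by rewrite -E -catA.
      case: (cat_cons_unique _ qM E4); last by move=> -> ->; rewrite -catA.
      by move: pM; rewrite !notin_cnt ?cntE; clear; lia.
    have E4 : e ++ 'M :: f = p ++ 'M :: ('B :: q) by rewrite -E -catA.
    case: (cat_cons_unique pM _ E4); last by move=> -> ->.
    by move: qM; rewrite !notin_cnt ?cntE.
  exists p, q, g, h; split; last by rewrite -efpq.
  have {}xE : a ++ 'A :: b = x by rewrite xE.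
  have {zE1} : a ++ 'M :: b = a' ++ 'C :: b' by rewrite -zE1.
  case: (split2 a' b' (etrans zE zE2)) => [[-> ->]|[-> ->]] E.
    have E4 : a ++ 'M :: b = (p ++ [:: 'C; 'B]) ++ 'M :: q by rewrite E -catA.
    right; case: (cat_cons_unique _ qM E4); last by move=> aE bE; rewrite -xE aE bE -catA.
    by move: pM; rewrite !notin_cnt ?cntE; clear; lia.
  have E4 : a ++ 'M :: b = p ++ 'M :: ('B :: 'C :: q) by rewrite E -catA.
  left; case: (cat_cons_unique pM _ E4); last by move=> aE bE; rewrite -xE aE bE.
  by move: qM; rewrite !notin_cnt ?cntE.
right; have cE c := congr1 (cnt c); split.
- by move: (cE nA _ _ zE1) (cE nA _ _ E) (cE nA _ _ efE) (cE nA _ _ zE2) (cE nA _ _ z2E') (cE nA _ _ z2E);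
  rewrite xE yE -zE !cntE; clear; lia.
- by move: (cE nC _ _ zE1) (cE nC _ _ E) (cE nC _ _ efE) (cE nC _ _ zE2) (cE nC _ _ z2E') (cE nC _ _ z2E);
  rewrite xE yE -zE !cntE; clear; lia.
by move: (cE nB _ _ zE1) (cE nB _ _ E) (cE nB _ _ efE) (cE nB _ _ zE2) (cE nB _ _ z2E') (cE nB _ _ z2E);
  rewrite xE yE -zE !cntE; clear; lia.
Qed.

(** Every cycle uses up one A and at least one B. *)
Lemma accepted_balance n x w : 'M \notin x -> steps red n x (map inl w) ->
  cnt nA x = cnt nC x -> cnt nA x <= cnt nB x.
Proof.
elim/ltn_ind: n x => n IH x xM /(red_cycle xM) [->|]; first by rewrite !cntE.
case=> m [y [mn yM yw [[p [q [a [b [xE [pqE yE]]]]]]|[xA xC xB]]]] AC.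
  have cE c : cnt c (p ++ 'B :: q) = cnt c (a ++ 'B :: b) by rewrite pqE.
  move: (IH m mn y yM yw) (cE nA) (cE nB) (cE nC) AC.
  by rewrite yE; case: xE => ->; rewrite !cntE; clear; lia.
by move: (IH m mn y yM yw); lia.
Qed.

Lemma remove_around (s1 m s3 a b : W) :
  s1 ++ 'A :: m ++ 'C :: s3 = a ++ 'B :: b ->
  exists s1' m' s3', a ++ b = s1' ++ 'A :: m' ++ 'C :: s3' /\
    (m' = m \/ exists m1 m2, m = m1 ++ 'B :: m2 /\ m' = m1 ++ m2).
Proof.
move=> E; case: (cat_eq_cat_cons E) => {E} [[c [_ ->]]|[[|z c] [E ->]]] //.
  by exists (a ++ c), m, s3; rewrite -catA; split=> //; left.
case: E => <- E; case: (cat_eq_cat_cons E) => {E} [[d [-> ->]]|[[|z' d] [E ->]]] //.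
  exists s1, (c ++ d), s3; split; first by rewrite -!catA.
  by right; exists c, d.
case: E => <- _; exists s1, m, (d ++ b); split; last by left.
by rewrite -!catA /= -catA.
Qed.

(** As many B's as A's leave no B to waste, so every cycle tests the center. Cycles peel A's and C's
    off the inside of the factor, each costing it at most one B, until a single B separates its two
    ends. Terminals in between would never go away. *)
Lemma accepted_core n x w l r : 'M \notin x -> steps red n x (map inl w) ->
  x = l ++ r -> 'C \notin l -> 'A \notin r ->
  cnt nA x = cnt nC x -> cnt nB x = cnt nA x ->
  forall s1 s2 s3, x = s1 ++ 'A :: s2 ++ 'C :: s3 -> cnt nA s2 = cnt nC s2 ->
  cnt nB s2 <= (cnt nA s2).+1 /\ ~~ has is_term s2.
Proof.
elim/ltn_ind: n x l r => n IH x l r xM xw xE lC rA AC BA s1 s2 s3 xE2 s2E.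
case: (red_cycle xM xw) => [xE3|]; first by move: (congr1 (cnt nA) xE2); rewrite xE3 !cntE; clear; lia.
case=> m [y [mn yM yw [[p [q [a [b [xE3 [pqE yE]]]]]]|[xA xC xB]]]]; last first.
  (* Losing two B's for one A would leave fewer B's than A's. *)
  by have := accepted_balance yM yw; lia.
(* All A's precede all C's, which excludes the order C, B, A. *)
have {xE3} xE3 : x = p ++ 'A :: 'B :: 'C :: q.
  case: xE3 => // xE3; move: xE; rewrite xE3 => /esym E.
  case: (cat_eq_cat_cons E) => [[c [lE _]]|[c [rE _]]].
    by move: lC; rewrite lE mem_cat mem_head orbT.
  by move: rA; rewrite rE !(mem_cat, inE) eqxx !orbT.
have pC : 'C \notin p.
  move: xE; rewrite xE3 => /esym E.
  case: (cat_eq_cat_cons E) => [[c [lE _]]|[c [rE pE]]].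
    by move: lC; rewrite lE !mem_cat !negb_or => /andP[].
  by move: rA; rewrite rE mem_cat mem_head orbT.
have qA : 'A \notin q.
  have E : l ++ r = (p ++ [:: 'A; 'B]) ++ 'C :: q by rewrite -xE xE3 -catA.
  case: (cat_eq_cat_cons E) => [[c [lE _]]|[c [rE pE]]].
    by move: lC; rewrite lE mem_cat mem_head orbT.
  by move: rA; rewrite rE !(mem_cat, inE) !negb_or => /and3P[].
have yl : exists l' r', [/\ y = l' ++ r', 'C \notin l' & 'A \notin r'].
  rewrite yE; case: (cat_eq_cat_cons pqE) => [[c [pE bE]]|[[|z c] [qE aE]]].
  - exists (a ++ c), ('B :: q); rewrite bE -catA; split=> //.
    by move: pC; rewrite pE !(mem_cat, inE) !negb_or /= => /andP[-> ->].
  - case: qE => qb; exists p, b; rewrite aE cats0; split=> //.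
    by move: qA; rewrite qb.
  - case: qE => zE qb; exists p, (z :: c ++ b); rewrite aE -catA; split=> //.
    by move: qA; rewrite qb -zE !notin_cnt !cntE; clear; lia.
have [l' [r' [yE' l'C r'A]]] := yl.
have cE c : cnt c (p ++ 'B :: q) = cnt c (a ++ 'B :: b) by rewrite pqE.
have yAC : cnt nA y = cnt nC y.
  by move: (cE nA) (cE nB) (cE nC) AC; rewrite yE xE3 !cntE; clear; lia.
have yBA : cnt nB y = cnt nA y.
  by move: (cE nA) (cE nB) (cE nC) BA; rewrite yE xE3 !cntE; clear; lia.
have {}IH := IH m mn y l' r' yM yw yE' l'C r'A yAC yBA.
have E : s1 ++ 'A :: s2 ++ 'C :: s3 = p ++ 'A :: 'B :: 'C :: q by rewrite -xE2.
case: (cat_eq_cat_cons E) => {E} [[c [_ E]]|[[|z c] [E pE]]].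
- by move: (congr1 (cnt nA) E) qA; rewrite notin_cnt !cntE; clear; lia.
(* The factor begins at the central A; equally many A's and C's inside then force it to end at the
   central C. *)
- case: E => E; have {}E : s2 ++ 'C :: s3 = [:: 'B] ++ 'C :: q by [].
  case: (cat_eq_cat_cons E) => [[d [s2E' qE]]|[[|z d] [_ BE]]].
  + by move: qA s2E; rewrite qE s2E' notin_cnt !cntE; clear; lia.
  + by move: BE; rewrite cats0 => <-.
  + by case: s2 BE {E s2E xE2} => [|? [|? ?]] //= [] // <-.
case: E => zE E; have {}E : s2 ++ 'C :: s3 = (c ++ [:: 'A; 'B]) ++ 'C :: q by rewrite E -catA.
have cC : 'C \notin c.
  by move: pC; rewrite pE -zE !(mem_cat, inE) !negb_or => /and3P[].
case: (cat_eq_cat_cons E) => [[d [s2E' qE]]|[d [dE cE']]]; last first.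
  have := congr1 (cnt nC) cE'; have := congr1 (cnt nA) cE'.
  move: cC s2E; rewrite notin_cnt !cntE.
  case: d dE cE' => [|z' d] [dE cE']; first by rewrite !cntE; clear; lia.
  by rewrite -dE !cntE; clear; lia.
(* The test turns the inside into [c ++ 'B :: d], from which the erased B may or may not be
   taken. *)
have E3 : s1 ++ 'A :: (c ++ 'B :: d) ++ 'C :: s3 = a ++ 'B :: b.
  by rewrite -pqE pE qE -zE -!catA.
case: (remove_around E3) => s1' [m' [s3' [abE m'E]]].
have m'c k : k != nB -> cnt k m' = cnt k (c ++ d).
  move=> kB; case: m'E => [->|[m1 [m2 [E4 ->]]]].
    by rewrite !cntE eq_sym (negbTE kB).
  by move: (congr1 (cnt k) E4); rewrite !cntE eq_sym (negbTE kB); clear; lia.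
have [||m'B m't] := IH s1' m' s3'; first by rewrite yE.
  by rewrite !m'c //; move: s2E; rewrite s2E' !cntE; clear; lia.
have m'B2 : cnt nB (c ++ d) <= cnt nB m'.
  case: m'E => [->|[m1 [m2 [E4 ->]]]]; first by rewrite !cntE; clear; lia.
  by move: (congr1 (cnt nB) E4); rewrite !cntE; clear; lia.
split.
  by move: m'B m'B2; rewrite (m'c nA) // s2E' !cntE; clear; lia.
have -> : has is_term s2 = has is_term (c ++ 'B :: d) by rewrite s2E' !has_cat /= orbF.
case: m'E m't => [->|[m1 [m2 [E4 ->]]]]; rewrite ?has_cat //.
by move: (congr1 (has is_term) E4); rewrite !has_cat /= => ->.
Qed.

Lemma red_terms x y : red x y -> terms y = terms x.
Proof.
have tE (a b : W) c : terms (a ++ inr c :: b) = terms a ++ terms b by rewrite /terms pmap_cat.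
have tD (a b : W) : terms (a ++ b) = terms a ++ terms b by rewrite /terms pmap_cat.
case=> [_|_|]; rewrite /mark_rules /check_rules /erase_rules /=.
- by move=> [a [b [-> [a' [b' [E <-]]]]]]; rewrite !tE -(tE a b nM) E tE.
- by move=> [a [b [-> <-]]]; rewrite tE tD.
- by move=> [a [b [-> [a' [b' [E <-]]]]]]; rewrite tE -tD E tE tD.
Qed.

Lemma steps_terms n x w : steps red n x (map inl w) -> terms x = w.
Proof.
elim: n x => [x -> |n IH x [z /red_terms <- /IH //]].
by elim: w => //= t w; rewrite /terms /= => ->.
Qed.

End Words.

Arguments cnt : simpl never.

(** * The matrix grammar of a domino system *)

Section Codes.
Variable X : finType.
Definition width := #|X|.
Local Notation K := width.

Definition rank (x : X) : nat := enum_rank x.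
Definition onehot k i : seq bool := [seq p == i | p <- iota 0 k].
(* All codes have the same length and the same number of ones, and no code is
   dominated by another one in all suffix sums. *)
Definition code (x : X) := onehot K (rank x) ++ onehot K (K.-1 - rank x).
Definition enc (s : seq X) := flatten (map code s).

Lemma count_drop_onehot k i j : i < k -> count id (drop j (onehot k i)) = (j <= i).
Proof.
move=> ik; rewrite /onehot -map_drop drop_iota count_map.
rewrite (@eq_count _ _ (pred1 i)) //.
by rewrite count_uniq_mem ?iota_uniq // mem_iota; lia.
Qed.

Lemma size_onehot k i : size (onehot k i) = k.
Proof. by rewrite size_map size_iota. Qed.

Lemma count_onehot k i : i < k -> count id (onehot k i) = 1.
Proof. by move=> ik; rewrite -[onehot k i]drop0 count_drop_onehot. Qed.

Lemma size_code x : size (code x) = K + K.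
Proof. by rewrite size_cat !size_onehot. Qed.

Lemma rank_lt (x : X) : rank x < K. Proof. exact: ltn_ord. Qed.

Lemma corank_lt (x : X) : K.-1 - rank x < K.
Proof. by have := rank_lt x; lia. Qed.

Lemma count_code x : count id (code x) = 2.
Proof. by rewrite count_cat !count_onehot ?rank_lt ?corank_lt. Qed.

(** The suffix from [rank x] compares the ranks, as the second halves add one on both sides. The
    suffix from the one in the second half of [code x] compares the reversed ranks and gives the
    converse inequality. *)
Lemma code_dominated x y :
  (forall j, count id (drop j (code x)) <= count id (drop j (code y))) -> x = y.
Proof.
move=> le_xy; suff : rank x = rank y by move=> /val_inj/enum_rank_inj.
have [xK yK] := (rank_lt x, rank_lt y).
have := le_xy (rank x).
rewrite !drop_cat !size_onehot xK !count_cat !count_drop_onehot // !count_onehot ?corank_lt // leqnn.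
have := le_xy (K + (K.-1 - rank x)).
rewrite !drop_cat !size_onehot ltnNge leq_addr /= addKn !count_drop_onehot ?corank_lt // leqnn.
rewrite leq_add2r !lt0b; clear le_xy; lia.
Qed.

Lemma drop_code_cat x s j : drop j (code x ++ s) =
  if j < K + K then drop j (code x) ++ s else drop (j - (K + K)) s.
Proof. by rewrite drop_cat size_code. Qed.

Lemma enc_cat s1 s2 : enc (s1 ++ s2) = enc s1 ++ enc s2.
Proof. by rewrite /enc map_cat flatten_cat. Qed.

Lemma size_enc s : size (enc s) = (K + K) * size s.
Proof. by elim: s => [|x s IH]; rewrite ?muln0 // /enc /= size_cat IH size_code mulnS. Qed.

Lemma count_enc s : count id (enc s) = 2 * size s.
Proof. by elim: s => [|x s IH] //; rewrite /enc /= count_cat IH count_code mulnS. Qed.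

Lemma enc_nil s : enc s = [::] -> s = [::].
Proof. by case: s => // x s /(congr1 (count id)); rewrite count_enc. Qed.

Lemma size_enc_inj s1 s2 : size (enc s1) = size (enc s2) -> size s1 = size s2.
Proof.
case: s1 s2 => [|x s1] [|y s2] //; rewrite !size_enc.
- by have := rank_lt y; rewrite /=; nia.
- by have := rank_lt x; rewrite /=; nia.
- by have := rank_lt x; rewrite /=; nia.
Qed.

(** All codes contain the same number of ones, so the tails cancel and the first codes can be
    compared alone. *)
Lemma enc_dominated s1 s2 : size s1 = size s2 ->
  (forall j, count id (drop j (enc s1)) <= count id (drop j (enc s2))) -> s1 = s2.
Proof.
elim: s1 s2 => [|x s1 IH] [|y s2] //= [sz] le12.
congr (_ :: _).
  apply: code_dominated => j; have := le12 j.
  rewrite /enc /= -/(enc s1) -/(enc s2) !drop_code_cat.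
  case: ltnP => jK; first by rewrite !count_cat !count_enc sz leq_add2r.
  by move=> _; rewrite (@drop_oversize _ j (code x)) ?size_code.
apply: IH => // j; have := le12 (K + K + j).
by rewrite /enc /= -/(enc s1) -/(enc s2) !drop_code_cat ltnNge leq_addr /= addKn.
Qed.

End Codes.

(** * The matrices and the letter counts of generated words *)

Section MatrixGrammar.
Variables (T X : finType) (D : seq (domino T X)) (u : seq X).
Local Notation W := (seq (symb T NT)).
Local Notation "''S'" := (inr nS : symb T NT).
Local Notation "''A'" := (inr nA : symb T NT).
Local Notation "''B'" := (inr nB : symb T NT).
Local Notation "''C'" := (inr nC : symb T NT).
Local Notation "''M'" := (inr nM : symb T NT).

Definition lenc (bs : seq bool) : W := flatten [seq 'A :: nseq b 'B | b : bool <- bs].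
Definition renc (bs : seq bool) : W :=
  flatten [seq rcons (nseq (~~ b) 'B) 'C | b : bool <- rev bs].

Definition gen_matrix (d : domino T X) : scm_matrix T NT :=
  SCMMatrix
    [:: (nS, map inl d.1.1 ++ lenc (enc d.1.2) ++ 'S :: renc (enc d.2))] [::] [::].
Definition stop_matrix : scm_matrix T NT :=
  SCMMatrix [:: (nS, lenc (enc u))] [::] [::].
Definition mark_matrix := SCMMatrix (mark_rules T) [::] [:: 'M].
Definition check_matrix := SCMMatrix (check_rules T) [:: 'M; 'B; 'M] [::].
Definition erase_matrix := SCMMatrix (erase_rules T) [::] [::].

Definition pcp_scm : scm_grammar T :=
  SCMGrammar nS
    [:: mark_matrix, check_matrix, erase_matrix, stop_matrix & map gen_matrix D].

Lemma pcp_scm_params : scm_params pcp_scm 3 1 5 2 2 0.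
Proof.
split=> /=.
- by rewrite all_map; apply/allP.
- by rewrite card_option card_prod card_bool.
- by rewrite count_map (@eq_count _ _ pred0) ?count_pred0.
- by rewrite all_map; apply/allP.
- by rewrite count_map (@eq_count _ _ pred0) ?count_pred0.
Qed.

Lemma lenc_cat a b : lenc (a ++ b) = lenc a ++ lenc b.
Proof. by rewrite /lenc map_cat flatten_cat. Qed.

Lemma renc_cat a b : renc (a ++ b) = renc b ++ renc a.
Proof. by rewrite /renc rev_cat map_cat flatten_cat. Qed.

Lemma lenc_cons (x : bool) a : lenc (x :: a) = 'A :: nseq x 'B ++ lenc a.
Proof. by []. Qed.

Lemma renc_cons y b : renc (y :: b) = renc b ++ rcons (nseq (~~ y) 'B) 'C.
Proof. by rewrite -cat1s renc_cat /renc /= cats0. Qed.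

Lemma cnt_lencA a : cnt nA (lenc a) = size a.
Proof. by elim: a => // x a IH; rewrite /lenc /= -/(lenc a) !cntE IH; case: x; rewrite /= ?cntE. Qed.
Lemma cnt_lencB a : cnt nB (lenc a) = count id a.
Proof. by elim: a => // x a IH; rewrite /lenc /= -/(lenc a) !cntE IH; case: x; rewrite /= ?cntE. Qed.
Lemma cnt_lenc0 c a : c != nA -> c != nB -> cnt c (lenc a) = 0.
Proof.
move=> /negbTE cA /negbTE cB; elim: a => // x a IH; rewrite /lenc /= -/(lenc a) !cntE IH [nA == c]eq_sym cA.
by case: x; rewrite /= ?cntE ?[nB == c]eq_sym ?cB.
Qed.
Lemma cnt_rencC a : cnt nC (renc a) = size a.
Proof. by elim: a => // x a IH; rewrite renc_cons !cntE IH -cats1; case: x; rewrite /= ?cntE ?addn1. Qed.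
Lemma cnt_rencB a : cnt nB (renc a) + count id a = size a.
Proof. by elim: a => // x a IH; rewrite renc_cons !cntE -cats1 /= -IH; case: x; rewrite /= ?cntE; lia. Qed.
Lemma cnt_renc0 c a : c != nC -> c != nB -> cnt c (renc a) = 0.
Proof.
move=> /negbTE cC /negbTE cB; elim: a => // x a IH; rewrite renc_cons !cntE IH -cats1.
by case: x; rewrite /= ?cntE [nC == c]eq_sym ?[nB == c]eq_sym ?cB ?cC.
Qed.

Definition left_part (g : seq (domino T X)) : W :=
  flatten [seq map inl d.1.1 ++ lenc (enc d.1.2) | d : domino T X <- g].
Definition generated (g : seq (domino T X)) : W :=
  (left_part g ++ lenc (enc u)) ++ renc (enc (lowers g)).

Lemma left_part_cons d g :
  left_part (d :: g) = map inl d.1.1 ++ lenc (enc d.1.2) ++ left_part g.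
Proof. by rewrite /left_part /= catA. Qed.

Lemma lowers_cons (d : domino T X) g : lowers (d :: g) = d.2 ++ lowers g.
Proof. by []. Qed.

Lemma uppers_cons (d : domino T X) g : uppers (d :: g) = d.1.2 ++ uppers g.
Proof. by []. Qed.

Lemma in_map_matrix r :
  List.In r (map gen_matrix D) <-> exists2 d, d \in D & r = gen_matrix d.
Proof.
elim: D => [|d D' IH] /=; first by split=> // [[]].
split=> [[<-|/IH[e eD ->]]|[e]]; first by exists d; rewrite ?mem_head.
  by exists e; rewrite // inE eD orbT.
by rewrite inE => /orP[/eqP -> ->|eD rE]; [left|right; apply/IH; exists e].
Qed.

Lemma scm_stepE x y : @scm_step T pcp_scm x y <->
  [\/ red x y, exists2 d, d \in D & apply_rules (m_rules (gen_matrix d)) x y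
    | apply_rules (m_rules stop_matrix) x y].
Proof.
split=> [[r [rM [P [F xy]]]]|].
  case: rM P F xy => [<-|[<-|[<-|[<-|/in_map_matrix[d dD ->]]]]] /=.
  - by move=> _ /(_ isT); rewrite infix1s => xM xy; constructor 1; constructor 1.
  - by move=> /(_ isT) xP _ xy; constructor 1; constructor 2.
  - by move=> _ _ xy; constructor 1; constructor 3.
  - by move=> _ _ xy; constructor 3.
  - by move=> _ _ xy; constructor 2; exists d.
have in_map d : d \in D -> List.In (gen_matrix d) (g_M pcp_scm).
  by move=> dD; do 4!right; apply/in_map_matrix; exists d.
case=> [[xM xy|xP xy|xy]|[d dD xy]|xy].
- by exists mark_matrix; split; [left|split=> //; split=> // _; rewrite infix1s].
- by exists check_matrix; split; [right; left|].
- by exists erase_matrix; split; [do 2!right; left|].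
- by exists (gen_matrix d); split; [exact: in_map|].
- by exists stop_matrix; split; [do 3!right; left|].
Qed.

(** * Moving generation before erasure *)

Lemma red_cntS (x y : W) : red x y -> cnt nS y = cnt nS x.
Proof.
case=> [_ [a [b [-> [c [d [E <-]]]]]]|_ [a [b [-> <-]]]|[a [b [-> [c [d [E <-]]]]]]].
- by move: (congr1 (@cnt T nS) E); rewrite !cntE; clear; lia.
- by rewrite !cntE.
- by move: (congr1 (@cnt T nS) E); rewrite !cntE; clear; lia.
Qed.

Lemma red_cntAC (x y : W) : red x y -> cnt nA x + cnt nC y = cnt nA y + cnt nC x.
Proof.
case=> [_ [a [b [-> [c [d [E <-]]]]]]|_ [a [b [-> <-]]]|[a [b [-> [c [d [E <-]]]]]]].
- by move: (congr1 (@cnt T nA) E) (congr1 (@cnt T nC) E); rewrite !cntE; clear; lia.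
- by rewrite !cntE; clear; lia.
- by move: (congr1 (@cnt T nA) E) (congr1 (@cnt T nC) E); rewrite !cntE; clear; lia.
Qed.

Lemma steps_cntAC n (x : W) w : steps (@red T) n x (map inl w) -> cnt nA x = cnt nC x.
Proof.
elim: n x => [x -> |n IH x [y /red_cntAC E /IH]]; first by rewrite !cntE.
by move: E; clear; lia.
Qed.

Lemma steps_of_star (x y : W) : cnt nS x = 0 -> star (@scm_step T pcp_scm) x y ->
  exists n, steps (@red T) n x y.
Proof.
move=> xS D0; elim: D0 xS => {x y} [x _|x y z /scm_stepE xy _ IH xS]; first by exists 0.
case: xy => [xy|[d _ [a [b [xE _]]]]|[a [b [xE _]]]].
- by case: IH => [|n yz]; [rewrite (red_cntS xy)|exists n.+1; exists y].
- by move: xS; rewrite xE !cntE; clear; lia.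
- by move: xS; rewrite xE !cntE; clear; lia.
Qed.

(* Erasing steps taken before generation stops commute with generation. *)
Lemma apply_rules_around rs (l r y : W) :
  all (fun p : NT * W => p.1 != nS) rs -> apply_rules rs (l ++ 'S :: r) y ->
  exists l' r', y = l' ++ 'S :: r' /\
    forall m, apply_rules rs (l ++ m ++ r) (l' ++ m ++ r').
Proof.
elim: rs l r => [|[A v] rs IH] l r /=; first by move=> _ <-; exists l, r.
case/andP=> AS rsS [a [b [E]]].
case: (cat_eq_cat_cons E) => {E} [[c [-> ->]]|[[|s c] [E ->]]].
- rewrite 2!catA => /(IH _ _ rsS) [l' [r' [-> H]]]; exists l', r'; split=> // m.
  by exists a, (c ++ m ++ r); rewrite -!catA; split=> //; move: (H m); rewrite -!catA.
- by case: E AS => <- _; rewrite eqxx.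
case: E => <- ->; rewrite -catA /= => /(IH _ _ rsS) [l' [r' [-> H]]].
exists l', r'; split=> // m; exists (l ++ m ++ c), b.
by rewrite -!catA; split=> //; move: (H m); rewrite -!catA.
Qed.

(** The factor that is tested for does not contain S, so it lies on one side of it. Replacing S by a
    mark-free word thus preserves both conditions. *)
Lemma red_around (l r y : W) : red (l ++ 'S :: r) y ->
  exists l' r', y = l' ++ 'S :: r' /\
    forall m, 'M \notin m -> red (l ++ m ++ r) (l' ++ m ++ r').
Proof.
case=> [xM|/infixP[p [q E]]|] /apply_rules_around => [[]//|[]//|[]//] l' [r' [yE H]];
  exists l', r'; split=> // m mM.
- constructor 1 => //; move: xM mM; rewrite !notin_cnt !cntE; clear; lia.
- constructor 2 => //; apply/infixP.
  have {}E : l ++ 'S :: r = p ++ 'M :: 'B :: 'M :: q by rewrite -E.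
  case: (cat_eq_cat_cons E) => {E} [[[|x1 [|x2 c]] [-> E]]|[[|s c] [E _]]] //.
    by case: E => <- <- _; exists p, (c ++ m ++ r); rewrite -!catA.
  case: E => _ ->; exists (l ++ m ++ c), q; by rewrite -!catA.
- by constructor 3.
Qed.

(** Induction on the derivation: a generating step extends [g], and an erasing step taken while S is
    present is postponed by [red_around]. *)
Lemma front_generation (l r : W) w : cnt nS l = 0 -> cnt nS r = 0 ->
  star (@scm_step T pcp_scm) (l ++ 'S :: r) (map inl w) ->
  exists2 g, {subset g <= D} & exists n, steps (@red T) n
    (l ++ (generated g) ++ r) (map inl w).
Proof.
move xE : (l ++ _) => x; move yE : (map inl w) => y lS rS xy.
elim: xy l r xE yE lS rS => {x y} [x|x y z /scm_stepE xy yz IH] l r xE yE lS rS.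
  by have := cnt_terms nS w; rewrite yE -xE !cntE; clear; lia.
have uniqS a b : x = a ++ 'S :: b -> a = l /\ b = r.
  by rewrite -xE => E; apply: cat_cons_unique (esym E); rewrite notin_cnt ?lS ?rS.
have cnt0 := (cnt_lenc0, cnt_renc0).
case: xy => [xy|[d dD [a [b [E yE2]]]]|[a [b [E yE2]]]].
- move: (xy); rewrite -xE => /red_around [l' [r' [y'E H]]].
  have [l'S r'S] : cnt nS l' = 0 /\ cnt nS r' = 0.
    by move: (red_cntS xy) lS rS; rewrite y'E -xE !cntE; clear; lia.
  have [g gD [n gn]] := IH l' r' (esym y'E) yE l'S r'S.
  exists g => //; exists n.+1; exists (l' ++ generated g ++ r') => //; apply: H.
  rewrite notin_cnt /generated !cntE !cnt0 // !addn0.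
  elim: (g) => // d g' IHg; rewrite left_part_cons !cntE !cnt0 //.
- case: (uniqS _ _ E) yE2 => -> -> /= yE2.
  case: (IH (l ++ map inl d.1.1 ++ lenc (enc d.1.2)) (renc (enc d.2) ++ r)).
  + by rewrite -yE2 -!catA.
  + by [].
  + by rewrite !cntE lS cnt0.
  + by rewrite !cntE rS cnt0.
  move=> g gD [n gn]; exists (d :: g).
    by move=> e; rewrite inE => /orP[/eqP -> //|/gD].
  exists n; move: gn.
  by rewrite /generated left_part_cons lowers_cons enc_cat renc_cat -!catA.
- case: (uniqS _ _ E) yE2 => -> -> /= yE2; exists [::] => //.
  apply: steps_of_star; last by rewrite /generated /= cats0 yE2.
  by rewrite /generated !cntE lS rS cnt0.
Qed.

(** * From domino solutions to derivations *)

Lemma star_reduce_center (P Q : W) : cnt nM P = 0 -> cnt nM Q = 0 ->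
  star (@red T) (P ++ 'A :: 'B :: 'C :: Q) (P ++ Q).
Proof.
move=> PM QM; apply: (@star_step _ _ _ (P ++ 'M :: 'B :: 'M :: Q)).
  constructor 1; first by rewrite notin_cnt !cntE PM QM.
  by exists P, ('B :: 'C :: Q); split=> //; exists (P ++ [:: 'M; 'B]), Q; rewrite -!catA.
apply: (@star_step _ _ _ (P ++ 'B :: 'M :: Q)).
  constructor 2; first by apply: infix_infix.
  by exists P, ('B :: 'M :: Q).
apply: star1; constructor 3; exists (P ++ [:: 'B]), Q; split; first by rewrite -catA.
by exists P, Q; rewrite -catA.
Qed.

(** For equal words the last bit [x] lies at the center, where its two codings contribute exactly
    one B. *)
Lemma star_reduce w a : star (@red T) (map inl w ++ lenc a ++ renc a) (map inl w).
Proof.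
elim/last_ind: a => [|a x]; first by rewrite cats0; apply: star_refl.
rewrite catA; apply: star_trans.
have -> : map inl w ++ lenc (rcons a x) ++ renc (rcons a x) =
    (map inl w ++ lenc a) ++ 'A :: 'B :: 'C :: renc a.
  rewrite -cats1 lenc_cat renc_cat -!catA; congr (_ ++ (_ ++ _)).
  by case: x.
by apply: star_reduce_center; rewrite ?cntE ?cnt_lenc0 ?cnt_renc0.
Qed.

Lemma star_generate g l r : {subset g <= D} ->
  star (@scm_step T pcp_scm) (l ++ 'S :: r) (l ++ generated g ++ r).
Proof.
elim: g l r => [|d g IH] l r gD.
  apply: star1; apply/scm_stepE; constructor 3; exists l, r; split=> //.
  by rewrite /generated /= cats0.
apply: (@star_step _ _ _ ((l ++ map inl d.1.1 ++ lenc (enc d.1.2)) ++ 'S :: (renc (enc d.2) ++ r))).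
  apply/scm_stepE; constructor 2; exists d; first by rewrite gD ?mem_head.
  by exists l, r; rewrite -!catA.
have -> : l ++ generated (d :: g) ++ r =
    (l ++ map inl d.1.1 ++ lenc (enc d.1.2)) ++ generated g ++ renc (enc d.2) ++ r.
  by rewrite /generated left_part_cons lowers_cons enc_cat renc_cat -!catA.
by apply: IH => e eg; apply: gD; rewrite inE eg orbT.
Qed.

Lemma left_part_emits_first g : emits_first g ->
  left_part g = map inl (emitted g) ++ lenc (enc (uppers g)).
Proof.
elim: g => // d g IH /= /andP[/IH gE dg]; rewrite left_part_cons gE uppers_cons enc_cat lenc_cat.
rewrite /emitted /= -/(emitted g) map_cat -!catA; congr (_ ++ _).
case/orP: dg => [/eqP -> //|silent].
have -> // : emitted g = [::].
by elim: (g) silent => //= e g' IHg /andP[/eqP eE /IHg]; rewrite /emitted /= eE.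
Qed.

(** * From derivations to domino solutions *)

Lemma emits_first_left_part g :
  (forall l1 l2, left_part g = l1 ++ 'A :: l2 -> ~~ has (@is_term T) l2) -> emits_first g.
Proof.
elim: g => // d g IH; rewrite left_part_cons => H /=; apply/andP; split.
  apply: IH => l1 l2 E; apply: (H (map inl d.1.1 ++ lenc (enc d.1.2) ++ l1)).
  by rewrite E -!catA.
case E: d.1.2 => [|x s] //=.
have : enc (d.1.2) != [::] by apply/eqP => /enc_nil; rewrite E.
case E2: (enc d.1.2) => [|b bs] // _.
have {H} : ~~ has (@is_term T) (left_part g).
  have := H (map inl d.1.1) _ _; rewrite E2 /lenc /= => /(_ _ erefl).
  by rewrite !has_cat !negb_or => /andP[_ ->].
elim: (g) => //= e g' IHg; rewrite left_part_cons has_cat negb_or => /andP[eT].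
rewrite has_cat negb_or => /andP[_ /IHg ->]; rewrite andbT.
by case: e.1.1 eT.
Qed.

Lemma split_at_count c n (r : W) : n < cnt c r ->
  exists r1 r2, r = r1 ++ inr c :: r2 /\ cnt c r1 = n.
Proof.
elim: r n => // a r IH n.
have [->|ac] := eqVneq a (inr c).
  case: n => [_|n]; first by exists [::], r.
  rewrite cnt_inr eqxx ltnS => /IH [r1 [r2 [-> <-]]].
  by exists (inr c :: r1), r2; rewrite cnt_inr eqxx.
have -> : cnt c (a :: r) = cnt c r by rewrite /cnt /= (negbTE ac).
case/IH=> r1 [r2 [-> <-]]; exists (a :: r1), r2; split=> //.
by rewrite /cnt /= (negbTE ac).
Qed.

Lemma left_part_cntA g : cnt nA (left_part g) = size (enc (uppers g)).
Proof.
elim: g => // d g IH; rewrite left_part_cons uppers_cons enc_cat size_cat !cntE IH.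
by rewrite cnt_lencA.
Qed.

Lemma left_part_cntB g : cnt nB (left_part g) = count id (enc (uppers g)).
Proof.
elim: g => // d g IH; rewrite left_part_cons uppers_cons enc_cat count_cat !cntE IH.
by rewrite cnt_lencB.
Qed.

Lemma left_part_cnt0 c g : c != nA -> c != nB -> cnt c (left_part g) = 0.
Proof.
move=> cA cB; elim: g => // d g IH.
by rewrite left_part_cons !cntE IH cnt_lenc0.
Qed.

Lemma terms_word w a b : terms (map inl w ++ lenc a ++ renc b) = w.
Proof.
have silent (s : W) : ~~ has (@is_term T) s -> terms s = [::].
  by elim: s => // c s IH /=; rewrite negb_or => /andP[cT /IH]; case: c cT.
rewrite /terms !pmap_cat -!/(terms _) (silent (lenc a)) ?(silent (renc b)) ?cats0.
- by elim: w => //= t w; rewrite /terms /= => ->.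
- by elim: b => // y b IH; rewrite renc_cons -cats1 !has_cat !negb_or IH; case: y.
- by elim: a => // x a IH; rewrite lenc_cons -cat1s !has_cat !negb_or IH; case: x.
Qed.

(** [accepted_core] is applied to pairs of an A and a C at equal distance from the center. It
    excludes terminals after an A, and its bound on B's says that the upper code is dominated by the
    lower one. *)
Lemma accepted_matches g n w : steps (@red T) n (generated g) (map inl w) ->
  [/\ emits_first g, uppers g ++ u = lowers g & emitted g = w].
Proof.
move=> gw; set a := enc (uppers g ++ u); set b := enc (lowers g).
have lA : cnt nA (left_part g ++ lenc (enc u)) = size a.
  by rewrite cntE left_part_cntA cnt_lencA -size_cat -enc_cat.
have lB : cnt nB (left_part g ++ lenc (enc u)) = count id a.
  by rewrite cntE left_part_cntB cnt_lencB -count_cat -enc_cat.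
have l0 c : c != nA -> c != nB -> cnt c (left_part g ++ lenc (enc u)) = 0.
  by move=> cA cB; rewrite cntE left_part_cnt0 ?cnt_lenc0.
have gc c : cnt c (generated g) =
    cnt c (left_part g ++ lenc (enc u)) + cnt c (renc b) by exact: cnt_cat.
have gM : 'M \notin generated g by rewrite notin_cnt gc l0 // cnt_renc0.
have AC := steps_cntAC gw.
have sab : size a = size b by move: AC; rewrite !gc lA l0 // cnt_rencC cnt_renc0 // addn0.
have cab : count id a = count id b by rewrite !count_enc (size_enc_inj sab).
have BA : cnt nB (generated g) = cnt nA (generated g).
  by rewrite !gc lA lB cab (@cnt_renc0 nA) // sab -(cnt_rencB b) addn0 addnC.
have lC : 'C \notin left_part g ++ lenc (enc u) by rewrite notin_cnt l0.
have rA : 'A \notin renc b by rewrite notin_cnt cnt_renc0.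
have core := accepted_core gM gw erefl lC rA AC BA.
have ef : emits_first g.
  apply: emits_first_left_part => l1 l2 E.
  (* The partner of the given A is the C preceded by as many C's as there are A's after it. *)
  have : cnt nA (l2 ++ lenc (enc u)) < cnt nC (renc b).
    by move: lA; rewrite cnt_rencC -sab E -catA => <-; rewrite !cntE; clear; lia.
  case/split_at_count=> r1 [r2 [rE r1E]].
  have [] := core l1 ((l2 ++ lenc (enc u)) ++ r1) r2.
  - by rewrite /generated -/b rE E -!catA.
  - move: (l0 nC isT isT) rA; rewrite E rE notin_cnt !cntE r1E !cntE.
    by clear; lia.
  by rewrite !has_cat !negb_or => _ /andP[/andP[]].
have gE : generated g = map inl (emitted g) ++ lenc a ++ renc b.
  by rewrite /generated left_part_emits_first // /a enc_cat lenc_cat -!catA.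
split=> //.
- apply: enc_dominated; first exact: size_enc_inj.
  move=> j; rewrite -/a -/b; have [ja|ja] := leqP (size a) j; first by rewrite drop_oversize.
  have jb : j < size b by rewrite -sab.
  (* Between the A and the C of bit [j] the B's count the ones of [drop j a] and the zeros of
     [drop j b]. The bound, the common length of these suffixes, yields the inequality of their
     ones. *)
  have [] := core (map inl (emitted g) ++ lenc (take j a))
    (nseq (nth false a j) 'B ++ lenc (drop j.+1 a) ++ renc (drop j.+1 b) ++ nseq (~~ nth false b j) 'B)
    (renc (take j b)).
  + rewrite gE -{1}(cat_take_drop j a) -{1}(cat_take_drop j b) (drop_nth false ja) (drop_nth false jb).
    by rewrite lenc_cat renc_cat lenc_cons renc_cons -cats1 -!catA /= -!catA.
  + have nB0 c (k : bool) : c != nB -> cnt c (nseq k 'B) = 0.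
      by move=> /negbTE cB; case: k => //=; rewrite !cntE eq_sym cB.
    rewrite !cntE !nB0 // cnt_lencA cnt_renc0 // cnt_lenc0 // cnt_rencC !size_drop sab.
    by rewrite !addn0.
  + have nBk (k : bool) : cnt nB (nseq k 'B) = k by case: k; rewrite //= !cntE.
    have nA0 (k : bool) : cnt nA (nseq k 'B) = 0 by case: k; rewrite //= !cntE.
    rewrite !cntE !nBk !nA0 cnt_lencA cnt_lencB (@cnt_renc0 nA) //.
    have := cnt_rencB (drop j.+1 b); rewrite !size_drop.
    rewrite (drop_nth false ja) (drop_nth false jb) /= -sab.
    move: (cnt _ _) (count _ _) (count _ _) => c1 c2 c3 + + _.
    by case: (nth false a j); case: (nth false b j); rewrite /=; clear -ja; lia.
by rewrite -(steps_terms gw) gE terms_word.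
Qed.

Theorem pcp_scm_lang w : scm_lang pcp_scm w <-> pcp_lang D u w.
Proof.
split=> [gw|[g [gD ef E <-]]].
  have [g gD [n gn]] := @front_generation [::] [::] w erefl erefl gw.
  have [|ef E wE] := @accepted_matches g n w; first by move: gn; rewrite cats0.
  by exists g.
apply: star_trans (@star_generate g [::] [::] gD) _.
have sub x y : star (@red T) x y -> star (@scm_step T pcp_scm) x y.
  elim=> {x y} [x|x y z xy _ IH]; first exact: star_refl.
  by apply: star_step IH; apply/scm_stepE; constructor 1.
have -> : generated g =
    map inl (emitted g) ++ lenc (enc (lowers g)) ++ renc (enc (lowers g)).
  by rewrite /generated left_part_emits_first // -E enc_cat lenc_cat -!catA.
by rewrite cats0; apply/sub/star_reduce.
Qed.

End MatrixGrammar.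

(** * Simulating matrices by a phrase structure grammar *)

Section Simulation.
Variables (T : finType) (G : scm_grammar T) (l : nat).
Hypothesis F_le1 : forall r, List.In r (g_M G) -> size (m_F r) <= 1.
Hypothesis len_le : forall r, List.In r (g_M G) -> size (m_rules r) <= l.
Local Notation V := (symb T (g_N G)).
Local Notation M := (g_M G).
Local Notation I := 'I_(size M).

Definition mat (i : I) : scm_matrix T (g_N G) := nth (SCMMatrix [::] [::] [::]) M i.

(** Three global states, and for each matrix two test states and the number of its rules already
    applied. *)
Definition head := (option bool + I * (bool + 'I_l.+1))%type.
Definition hStart : head := inl None.
Definition hIdle : head := inl (Some false).
Definition hFinish : head := inl (Some true).
Definition hPermit i : head := inr (i, inl false).
Definition hForbid i : head := inr (i, inl true).
Definition hApply i k : head := inr (i, inr (inord k)).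

(** Terminals of the matrix grammar are kept as nonterminal letters too, so that true terminals
    appear only in the finishing scan. *)
Definition sim_N := (V + bool + head)%type.
Local Notation Y := (symb T sim_N).
Definition letter (v : V) : Y := inr (inl (inl v)).
Definition lend : Y := inr (inl (inr false)).
Definition rend : Y := inr (inl (inr true)).
Definition hd (h : head) : Y := inr (inr h).

(** The forbidding head moves only to the right and only over letters outside [m_F], so reaching the
    right end certifies the condition. *)
Definition crosses_right (h : head) (v : V) : bool :=
  match h with
  | inl (Some false) => true
  | inl _ => false
  | inr (i, inl true) => v \notin m_F (mat i)
  | inr _ => true
  end.
Definition crosses_left (h : head) : bool :=
  match h with
  | inl (Some false) => true
  | inl _ => false
  | inr (i, inl true) => false
  | inr _ => true
  end.

Definition rule_at (i : I) (k : nat) := nth (g_S G, [::]) (m_rules (mat i)) k.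

(* [(p, h, q, v)] stands for the rule [p h q -> v]. *)
Definition head_rules : seq (seq Y * head * seq Y * seq Y) :=
  [:: ([::], hStart, [::], [:: lend; hd hIdle; letter (inr (g_S G)); rend]);
      ([:: lend], hIdle, [::], [:: hd hFinish]);
      ([::], hFinish, [:: rend], [::])] ++
  [seq ([::], hFinish, [:: letter (inl t)], [:: inl t; hd hFinish]) | t <- enum T] ++
  [seq ([::], hv.1, [:: letter hv.2], [:: letter hv.2; hd hv.1])
    | hv <- enum {: head * V} & crosses_right hv.1 hv.2] ++
  [seq ([:: letter hv.2], hv.1, [::], [:: hd hv.1; letter hv.2])
    | hv <- enum {: head * V} & crosses_left hv.1] ++
  [seq ([::], hIdle, map letter (m_P (mat i)), hd (hPermit i) :: map letter (m_P (mat i)))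
    | i <- enum I] ++
  [seq ([:: lend], hPermit i, [::], [:: lend; hd (hForbid i)]) | i <- enum I] ++
  [seq ([::], hForbid i, [:: rend], [:: hd (hApply i 0); rend]) | i <- enum I] ++
  [seq ([::], hApply ik.1 ik.2, [:: letter (inr (rule_at ik.1 ik.2).1)],
        hd (hApply ik.1 ik.2.+1) :: map letter (rule_at ik.1 ik.2).2)
    | ik : I * 'I_l.+1 <- enum {: I * 'I_l.+1} & ik.2 < size (m_rules (mat ik.1))] ++
  [seq ([::], hApply i (size (m_rules (mat i))), [::], [:: hd hIdle]) | i <- enum I].

Definition sim_grammar : ps_grammar T :=
  @PSGrammar T sim_N (inr hStart)
    [seq (r.1.1.1 ++ hd r.1.1.2 :: r.1.2, r.2) | r <- head_rules].

Inductive head_rule : seq Y -> head -> seq Y -> seq Y -> Prop :=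
| rule_start : head_rule [::] hStart [::] [:: lend; hd hIdle; letter (inr (g_S G)); rend]
| rule_finish : head_rule [:: lend] hIdle [::] [:: hd hFinish]
| rule_end : head_rule [::] hFinish [:: rend] [::]
| rule_emit t : head_rule [::] hFinish [:: letter (inl t)] [:: inl t; hd hFinish]
| rule_right h v of crosses_right h v :
    head_rule [::] h [:: letter v] [:: letter v; hd h]
| rule_left h v of crosses_left h : head_rule [:: letter v] h [::] [:: hd h; letter v]
| rule_permit i :
    head_rule [::] hIdle (map letter (m_P (mat i))) (hd (hPermit i) :: map letter (m_P (mat i)))
| rule_forbid i : head_rule [:: lend] (hPermit i) [::] [:: lend; hd (hForbid i)]
| rule_ready i : head_rule [::] (hForbid i) [:: rend] [:: hd (hApply i 0); rend]
| rule_apply i k of k <= l & k < size (m_rules (mat i)) :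
    head_rule [::] (hApply i k) [:: letter (inr (rule_at i k).1)]
      (hd (hApply i k.+1) :: map letter (rule_at i k).2)
| rule_done i :
    head_rule [::] (hApply i (size (m_rules (mat i)))) [::] [:: hd hIdle].

Lemma head_ruleP p h q v : head_rule p h q v <-> (p, h, q, v) \in head_rules.
Proof.
rewrite /head_rules !mem_cat; split.
  case=> [|||t|h' v' hv|h' v' hv|i|i|i|i k kl ki|i]; first by rewrite !inE eqxx.
  - by rewrite !inE eqxx orbT.
  - by rewrite !inE eqxx !orbT.
  - do 1!(apply/orP; right); apply/orP; left.
    by apply/mapP; exists t; rewrite ?mem_enum.
  - do 2!(apply/orP; right); apply/orP; left.
    by apply/mapP; exists (h', v') => //; rewrite mem_filter hv mem_enum.
  - do 3!(apply/orP; right); apply/orP; left.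
    by apply/mapP; exists (h', v') => //; rewrite mem_filter hv mem_enum.
  - do 4!(apply/orP; right); apply/orP; left.
    by apply/mapP; exists i; rewrite ?mem_enum.
  - do 5!(apply/orP; right); apply/orP; left.
    by apply/mapP; exists i; rewrite ?mem_enum.
  - do 6!(apply/orP; right); apply/orP; left.
    by apply/mapP; exists i; rewrite ?mem_enum.
  - do 7!(apply/orP; right); apply/orP; left.
    apply/mapP; exists (i, inord k); last by rewrite /= inordK.
    by rewrite mem_filter mem_enum /= inordK // ki.
  - do 8!(apply/orP; right).
    by apply/mapP; exists i; rewrite ?mem_enum.
case/orP; first by rewrite !inE => /or3P[] /eqP[-> -> -> ->]; constructor.
case/orP; first by case/mapP=> t _ [-> -> -> ->]; constructor.
case/orP; first by case/mapP=> [[h' v']]; rewrite mem_filter => /andP[hv _] [-> -> -> ->]; constructor.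
case/orP; first by case/mapP=> [[h' v']]; rewrite mem_filter => /andP[hv _] [-> -> -> ->]; constructor.
case/orP; first by case/mapP=> t _ [-> -> -> ->]; constructor.
case/orP; first by case/mapP=> t _ [-> -> -> ->]; constructor.
case/orP; first by case/mapP=> t _ [-> -> -> ->]; constructor.
case/orP; last by case/mapP=> t _ [-> -> -> ->]; constructor.
case/mapP=> [[i k]]; rewrite mem_filter => /andP[ki _] [-> -> -> ->].
by constructor; rewrite // -ltnS.
Qed.

Lemma sim_stepE x y : @ps_step T sim_grammar x y <-> exists p h q v c d,
  [/\ head_rule p h q v, x = c ++ (p ++ hd h :: q) ++ d & y = c ++ v ++ d].
Proof.
split=> [[r [/mapP[[[[p h] q] v] /head_ruleP R ->] [_ [c [d [-> ->]]]]]]|].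
  by exists p, h, q, v, c, d.
case=> p [h [q [v [c [d [/head_ruleP R -> ->]]]]]].
exists (p ++ hd h :: q, v); split; first by apply/mapP; exists (p, h, q, v).
by split; [rewrite has_cat /= orbT|exists c, d].
Qed.

(** * Simulating a derivation of the matrix grammar *)

Definition conf h (a b : seq V) : seq Y := lend :: map letter a ++ hd h :: map letter b ++ [:: rend].

Local Notation sim_star := (star (@ps_step T sim_grammar)).

Lemma sim_rule p h q v c d : head_rule p h q v ->
  sim_star (c ++ (p ++ hd h :: q) ++ d) (c ++ v ++ d).
Proof. by move=> R; apply: star1; apply/sim_stepE; exists p, h, q, v, c, d. Qed.

Lemma sim_move_right h a b c : all (crosses_right h) b ->
  sim_star (conf h a (b ++ c)) (conf h (a ++ b) c).
Proof.
elim: b a => [|v b IH] a /=; first by rewrite cats0 => _; apply: star_refl.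
case/andP=> /rule_right/sim_rule R /IH {}IH.
apply: star_trans (R (lend :: map letter a) (map letter (b ++ c) ++ [:: rend])) _.
by move: (IH (rcons a v)); rewrite /conf cat_rcons -cats1 !map_cat -!catA.
Qed.

Lemma sim_move_left h a b : crosses_left h -> sim_star (conf h a b) (conf h [::] (a ++ b)).
Proof.
move=> hl; elim/last_ind: a b => [|a v IH] b; first exact: star_refl.
have /sim_rule R := @rule_left h v hl.
have {}R : sim_star (conf h (rcons a v) b) (conf h a (v :: b)).
  move: (R (lend :: map letter a) (map letter b ++ [:: rend])).
  by rewrite /conf map_rcons -cats1 /= -!catA.
by rewrite cat_rcons; apply: star_trans R (IH _).
Qed.

Lemma mat_in i : List.In (mat i) M.
Proof.
rewrite /mat; have := ltn_ord i; move: (nat_of_ord i) => k {i}.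
by elim: M k => // r rs IH [|k] /=; [left|right; apply: IH].
Qed.

Lemma in_mat r : List.In r M -> exists i, mat i = r.
Proof.
move=> rM; suff [k kM <-] : exists2 k, k < size M & nth (SCMMatrix [::] [::] [::]) M k = r.
  by exists (Ordinal kM).
elim: M rM => //= r' rs IH [->|/IH[k ks <-]]; first by exists 0.
by exists k.+1.
Qed.

Lemma sim_apply i rs k x y : drop k (m_rules (mat i)) = rs -> k + size rs = size (m_rules (mat i)) ->
  apply_rules rs x y ->
  sim_star (conf (hApply i k) [::] x)
           (conf (hApply i (size (m_rules (mat i)))) [::] y).
Proof.
elim: rs k x => [|[A v] rs IH] k x /=.
  by move=> _; rewrite addn0 => -> ->; apply: star_refl.
move=> dk sk [a [b [-> ry]]].
have ki : k < size (m_rules (mat i)) by rewrite -sk -addSnnS leq_addr.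
have /andP[/eqP rk /eqP dk'] : (rule_at i k == (A, v)) && (drop k.+1 (m_rules (mat i)) == rs).
  by move: dk; rewrite (drop_nth (g_S G, [::]) ki) -/(rule_at i k) => -[-> ->]; rewrite !eqxx.
have kl : k <= l by apply: ltnW; apply: leq_trans ki (len_le (mat_in i)).
have /sim_rule R := rule_apply kl ki.
apply: star_trans (@sim_move_right _ [::] a _ _) _; first by apply/allP.
apply: star_trans (_ : sim_star _ (conf (hApply i k.+1) a (v ++ b))) _.
  move: (R (lend :: map letter a) (map letter b ++ [:: rend])).
  by rewrite rk /conf !map_cat -!catA.
apply: star_trans (@sim_move_left _ a _ _) _ => //.
by apply: IH => //; rewrite addSnnS.
Qed.

Lemma sim_scm_step x y : @scm_step T G x y ->
  sim_star (conf hIdle [::] x) (conf hIdle [::] y).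
Proof.
case=> r [/in_mat[i <-] [Px [Fx xy]]].
have [a [b xE]] : exists a b, x = a ++ m_P (mat i) ++ b.
  have [->|/Px/infixP[a [b ->]]] := eqVneq (m_P (mat i)) [::]; first by exists [::], x.
  by exists a, b.
apply: star_trans (_ : sim_star _ (conf (hPermit i) [::] x)) _.
  rewrite {1}xE; apply: star_trans (@sim_move_right _ [::] a _ _) _; first by apply/allP.
  have /sim_rule R := rule_permit i.
  apply: star_trans (_ : sim_star _ (conf (hPermit i) a (m_P (mat i) ++ b))) _.
    move: (R (lend :: map letter a) (map letter b ++ [:: rend])).
    by rewrite /conf !map_cat -!catA.
  by rewrite xE; apply: sim_move_left.
have /sim_rule R2 := rule_forbid i.
apply: star_trans (R2 [::] (map letter x ++ [:: rend])) _.
apply: star_trans (_ : sim_star _ (conf (hForbid i) x [::])) _.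
  have := @sim_move_right (hForbid i) [::] x [::]; rewrite cats0; apply.
  (* A forbidden word of length at most one can be excluded letter by letter. *)
  apply/allP=> v vx /=; apply/negP=> vF.
  have := F_le1 (mat_in i); case E: (m_F (mat i)) vF Fx => [|c [|]] //.
  by rewrite inE => /eqP <- /(_ isT); rewrite infix1s vx.
have /sim_rule R3 := rule_ready i.
apply: star_trans (R3 (lend :: map letter x) [::]) _.
apply: star_trans (_ : sim_star _ (conf (hApply i 0) [::] (x ++ [::]))) _.
  exact: (@sim_move_left _ x [::]).
rewrite cats0; apply: star_trans (@sim_apply i _ 0 x y _ _ xy) _; rewrite ?drop0 //.
have /sim_rule R4 := rule_done i.
exact: (R4 [:: lend] (map letter y ++ [:: rend])).
Qed.

Lemma sim_complete w : scm_lang G w -> ps_lang sim_grammar w.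
Proof.
move=> D; have /sim_rule R0 := rule_start.
apply: star_trans (R0 [::] [::]) _; rewrite cats0.
have D' : sim_star (conf hIdle [::] [:: inr (g_S G)]) (conf hIdle [::] (map inl w)).
  elim: D => {w} [x|x y z /sim_scm_step xy _ IH]; first exact: star_refl.
  exact: star_trans xy IH.
apply: star_trans D' _.
have /sim_rule R1 := rule_finish.
apply: star_trans (R1 [::] (map letter (map inl w) ++ [:: rend])) _.
suff E u : sim_star (map inl u ++ hd hFinish :: map letter (map inl w) ++ [:: rend])
    (map inl (u ++ w)) by apply: (E [::]).
elim: w u {D} => [|t w IH] u.
  have /sim_rule R := rule_end.
  by move: (R (map inl u) [::]); rewrite !cats0.
have /sim_rule R := rule_emit t.
apply: star_trans (R (map inl u) (map letter (map inl w) ++ [:: rend])) _.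
by move: (IH (rcons u t)); rewrite cat_rcons map_rcons cat_rcons.
Qed.

(** * Soundness of the simulation by an invariant *)

Definition is_head (a : Y) := if a is inr (inr _) then true else false.

Lemma head_position (a b c d : seq Y) h h' : ~~ has is_head a -> ~~ has is_head b ->
  a ++ hd h :: b = c ++ hd h' :: d -> [/\ c = a, h' = h & d = b].
Proof.
move=> ah bh E; case: (cat_eq_cat_cons E) => {E} [[e [aE _]]|[[|z e] [E ->]]].
- by move: ah; rewrite aE has_cat /= orbT.
- by case: E => -> ->; rewrite cats0.
- by case: E bh => _ ->; rewrite has_cat /= orbT.
Qed.

Lemma no_head_lets a : ~~ has is_head (map letter a). Proof. by elim: a. Qed.

Lemma no_head_terms (w : seq T) : ~~ has is_head (map inl w : seq Y).
Proof. by elim: w. Qed.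

Lemma map_let_prefix b p d : map letter b ++ [:: rend] = map letter p ++ d ->
  exists b', b = p ++ b' /\ d = map letter b' ++ [:: rend].
Proof.
elim: p b => [|v p IH] [|v' b] //= E; first by exists [::].
  by exists (v' :: b).
by case: E => -> /IH [b' [-> ->]]; exists b'.
Qed.

Lemma map_let_rend b d : map letter b ++ [:: rend] = rend :: d -> b = [::] /\ d = [::].
Proof. by case: b => [|v b] //= []. Qed.

Lemma map_let_suffix a c v : lend :: map letter a = c ++ [:: letter v] ->
  exists a', a = rcons a' v /\ c = lend :: map letter a'.
Proof.
case/lastP: a => [|a v']; first by case: c => [|? []].
rewrite map_rcons -rcons_cons cats1 => /rcons_inj[<- ->].
by exists a.
Qed.

Lemma map_let_lend a c : lend :: map letter a = c ++ [:: lend] -> a = [::] /\ c = [::].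
Proof.
case/lastP: a => [|a v]; first by case: c => [|? []].
by rewrite map_rcons -rcons_cons cats1 => /rcons_inj[].
Qed.

Definition derived (y : seq V) := star (@scm_step T G) [:: inr (g_S G)] y.

Definition tested (P F y : seq V) :=
  [/\ derived y, P != [::] -> infix P y & F != [::] -> ~~ infix F y].

(** What a configuration certifies. During the application of a matrix the word [y] on which its
    conditions were tested is remembered, since they concern the word before the first rule. The
    start and finish heads never stand between two end markers, hence [False]. *)
Definition meaning (h : head) (a b : seq V) : Prop :=
  match h with
  | inl (Some false) => derived (a ++ b)
  | inl _ => False
  | inr (i, inl false) => tested (m_P (mat i)) [::] (a ++ b)
  | inr (i, inl true) => tested (m_P (mat i)) [::] (a ++ b) /\
      all (fun v => v \notin m_F (mat i)) a
  | inr (i, inr k) => exists2 y, tested (m_P (mat i)) (m_F (mat i)) y &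
      forall z, apply_rules (drop k (m_rules (mat i))) (a ++ b) z ->
                apply_rules (m_rules (mat i)) y z
  end.

Inductive sim_inv : seq Y -> Prop :=
| inv_start : sim_inv [:: hd hStart]
| inv_conf h a b of meaning h a b : sim_inv (conf h a b)
| inv_finish w b of derived (map inl w ++ b) :
    sim_inv (map inl w ++ hd hFinish :: map letter b ++ [:: rend])
| inv_done w of derived (map inl w) : sim_inv (map inl w).

Lemma meaning_apply i k a b : k <= l ->
  meaning (hApply i k) a b <-> exists2 y, tested (m_P (mat i)) (m_F (mat i)) y &
      forall z, apply_rules (drop k (m_rules (mat i))) (a ++ b) z ->
                apply_rules (m_rules (mat i)) y z.
Proof. by move=> kl; rewrite /meaning /hApply inordK. Qed.

Lemma sim_inv_conf p h q v c d a b : head_rule p h q v -> meaning h a b ->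
  c ++ p = lend :: map letter a -> q ++ d = map letter b ++ [:: rend] ->
  sim_inv (c ++ v ++ d).
Proof.
move=> R; case: R a b => {p h q v} [|||t|h v hv|h v hv|i|i|i|i k kl ki|i] a b.
- by [].
- by move=> /= D /esym/map_let_lend[aE ->] dE; rewrite dE; move: D; rewrite aE; apply: (@inv_finish [::]).
- by [].
- by [].
- move=> mh; rewrite cats0 => -> dE.
  have [b' [bE ->]] := @map_let_prefix b [:: v] d (esym dE).
  suff : sim_inv (conf h (rcons a v) b') by rewrite /conf map_rcons cat_rcons.
  apply: inv_conf; move: mh hv; rewrite bE.
  case: h => [[[]|]|[i [[]|k]]] //=; rewrite ?cat_rcons // => -[Di Fa] vF.
  by split=> //; rewrite all_rcons vF.
- move=> mh /esym/map_let_suffix[a' [aE ->]] /= ->.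
  apply: (@inv_conf h a' (v :: b)).
  by move: mh hv; rewrite aE; case: h => [[[]|]|[i [[]|k]]] //=; rewrite cat_rcons.
- move=> mh; rewrite cats0 => -> /esym/map_let_prefix[b' [bE ->]].
  suff : sim_inv (conf (hPermit i) a b) by rewrite bE /conf map_cat -!catA.
  by apply: inv_conf; split=> //= _; rewrite bE; apply: infix_infix.
- move=> mh /esym/map_let_lend[aE ->] /= ->.
  by apply: (@inv_conf (hForbid i) [::] b); move: mh; rewrite aE.
- case=> [[D Px _] Fa]; rewrite cats0 => -> /= /esym/map_let_rend[bE ->].
  apply: (@inv_conf (hApply i 0) a [::]); apply/meaning_apply => //.
  move: D Px; rewrite bE cats0 => D Px; exists a; last by rewrite drop0.
  (* The completed scan shows that already the first letter of the forbidden word is missing from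
     [a]. *)
  split=> //; case: (m_F (mat i)) Fa => // f F Fa _; apply/negP=> /infixP[s [s' aE]].
  by have := allP Fa f; rewrite aE !mem_cat !inE eqxx !orbT => /(_ isT).
- move=> /(meaning_apply _ _ _ kl)[y ty yz]; rewrite cats0 => -> dE.
  have [b' [bE ->]] := @map_let_prefix b [:: _] d (esym dE).
  suff : sim_inv (conf (hApply i k.+1) a ((rule_at i k).2 ++ b')).
    by rewrite /conf map_cat -!catA.
  apply/inv_conf/meaning_apply; first exact: leq_trans ki (len_le (mat_in i)).
  exists y => // z Hz; apply: yz.
  rewrite (drop_nth (g_S G, [::]) ki) -/(rule_at i k).
  by move: bE Hz; case: (rule_at i k) => A u /= -> Hz; exists a, b'.
- move=> /(meaning_apply _ _ _ (len_le (mat_in i)))[y [Dy Py Fy] yz].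
  rewrite cats0 => -> /= ->; apply: (@inv_conf hIdle a b) => /=.
  apply: star_trans Dy (star1 _); exists (mat i); split; first exact: mat_in.
  by split=> //; split=> //; apply: yz; rewrite drop_size.
Qed.

Lemma sim_inv_step x y : @ps_step T sim_grammar x y -> sim_inv x -> sim_inv y.
Proof.
case/sim_stepE=> p [h [q [v [c [d [R xE ->]]]]]] Ix.
have {}xE : x = (c ++ p) ++ hd h :: q ++ d by rewrite xE -!catA.
case: Ix xE => {x} [|h' a b mh|w b D|w D] xE.
- have [//|//|cp hE qd] := @head_position [::] [::] _ _ _ _ _ _ xE.
  case: R cp hE qd {xE} => {p h q v} // [|h v hv _ hE]; last by rewrite hE in hv.
  case: c d => [|? ?] [|? ?] // _ _ _.
  by apply: (@inv_conf hIdle [::] [:: inr (g_S G)]); apply: star_refl.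
- have [||cp hE qd] := @head_position (lend :: map letter a) (map letter b ++ [:: rend]) _ _ _ _ _ _ xE.
  + by rewrite /= no_head_lets.
  + by rewrite has_cat negb_or no_head_lets.
  by apply: (sim_inv_conf R _ cp qd); rewrite hE.
- have [||cp hE qd] := @head_position (map inl w) (map letter b ++ [:: rend]) _ _ _ _ _ _ xE.
  + by rewrite no_head_terms.
  + by rewrite has_cat negb_or no_head_lets.
  case: R cp hE qd {xE} => {p h q v} // [|t|h v hv|h v hv] => [cp _|cp _|_ hE|_ hE];
    try by rewrite hE in hv.
    move: cp; rewrite cats0 => -> /esym/map_let_rend[bE ->].
    by rewrite cats0; apply: inv_done; move: D; rewrite bE cats0.
  move: cp; rewrite cats0 => -> /esym E.
  have [b' [bE ->]] := @map_let_prefix b [:: inl t] d E.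
  suff : sim_inv (map inl (rcons w t) ++ hd hFinish :: map letter b' ++ [:: rend]).
    by rewrite map_rcons cat_rcons.
  by apply: inv_finish; move: D; rewrite bE map_rcons cat_rcons.
by have := no_head_terms w; rewrite xE has_cat /= orbT.
Qed.

Lemma sim_sound w : ps_lang sim_grammar w -> scm_lang G w.
Proof.
move=> D; have I0 : sim_inv [:: hd hStart] by constructor.
have {I0} : sim_inv (map inl w).
  by elim: D I0 => // x y z xy _ IH /(sim_inv_step xy).
move wE : (map inl w) => x Ix; case: Ix wE => {x} [|h a b _|u b _|u Du] E.
- by case: w E {D}.
- by have := no_head_terms w; rewrite E /conf /= has_cat /= orbT.
- by have := no_head_terms w; rewrite E /conf /= has_cat /= orbT.
by have -> : w = u by elim: w u E {D Du} => [|t w IH] [|t' u] //= [-> /IH ->].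
Qed.

Theorem scm_lang_sim w : scm_lang G w <-> ps_lang sim_grammar w.
Proof. by split; [apply: sim_complete|apply: sim_sound]. Qed.

End Simulation.

(** * Combining the constructions *)

Lemma all_In (A : Type) (p : pred A) s r : all p s -> List.In r s -> p r.
Proof. by elim: s => //= a s IH /andP[pa /IH ps] [<-|/ps]. Qed.

Theorem mainTheorem2 (T : finType) (L : language T) :
  in_SSCM 3 1 5 2 2 L <-> RE L.
Proof.
split=> [[G [[deg _ _ len _] LG]]|[G LG]].
  exists (sim_grammar G 2) => w; rewrite LG; apply: scm_lang_sim.
    by move=> r /(all_In deg)/andP[].
  by move=> r /(all_In len)/andP[].
exists (pcp_scm (ps_dominoes G) (ps_final G)); split; first exact: pcp_scm_params.
by move=> w; rewrite LG ps_lang_pcp pcp_scm_lang.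
Qed.
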